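(* Let $\theta:(0,1)\times(-1,1)\to(0,\pi)$ be the fractional contact angle function, i.e. for $s\in(0,1)$ and $\sigma\in(-1,1)$, $\theta=\theta(s,\sigma)\in(0,\pi)$ is defined implicitly by $$1+\sigma=(\sin\theta)^s\,\frac{M(\theta,s)}{M\left(\frac{\pi}{2},s\right)},\qquad M(\theta,s)=2\int_0^{\theta}\left[\int_0^{+\infty}\frac{r\,dr}{(r^2+2r\cos t+1)^{\frac{2+s}{2}}}\right]dt .$$ The function $$\sigma\mapsto 2\sigma\log 2+(1-\sigma)\log(1-\sigma)-(1+\sigma)\log(1+\sigma)$$ is strictly concave on $(-1,0)$, strictly convex on $(0,1)$, and takes the value $0$ at $\sigma=0,1,-1$. As a consequence, $$\theta(s,\sigma)<\arccos(-\sigma)\quad\forall\sigma\in(-1,0),\qquad \theta(s,\sigma)>\arccos(-\sigma)\quad\forall\sigma\in(0,1),$$ provided $s$ is close enough to $1$. Correspondingly, for $s$ close to $1$, in the hydrophilic regime $\sigma\in(-1,0)$ fractional droplets are more hydrophilic than their classical counterparts, while in the hydrophobic case they are more hydrophobic. Moreover, since $$\frac{\pi}{2}(1+\sigma)<\arccos(-\sigma)\quad\forall\sigma\in(-1,0),\qquad \frac{\pi}{2}(1+\sigma)>\arccos(-\sigma)\quad\forall\sigma\in(0,1),$$ the same assertions hold for $s$ close to $0$.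
   Context: The equation in the claim defines $\theta\in C^\infty((0,1)\times(-1,1);(0,\pi))$; $\theta(s,\sigma)$ is the contact angle prescribed by the fractional Young's law with relative adhesion coefficient $\sigma$, and $\arccos(-\sigma)$ is the contact angle given by the classical Young's law. The consequence for $s$ near $1$ is drawn from the expansion, as $s\to1^-$ for every $\sigma\in(-1,1)$, $\theta(s,\sigma)=\arccos(-\sigma)-\frac{2\sigma\log 2+(1-\sigma)\log(1-\sigma)-(1+\sigma)\log(1+\sigma)}{2\sqrt{1-\sigma^2}}(1-s)+o(1-s)$; the one for $s$ near $0$ from $\lim_{s\to0^+}\theta(s,\sigma)=\frac{\pi}{2}(1+\sigma)$. Approximate plots suggest (without proof) that the same inequalities should hold for every $s\in(0,1)$. *)

(* Defs.v *)
From Stdlib Require Import Reals.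
From Coquelicot Require Import Coquelicot.
Open Scope R_scope.

(* For 0 <= t < PI the base r^2 + 2 r cos t + 1 is positive, where [Rpower]
   is the real power; the improper integral in r converges and is continuous
   in t, so both (total) integral operators return the actual integrals when
   0 < s and 0 <= theta < PI. *)
Definition M (theta s : R) : R :=
  2 * RInt (fun t =>
        RInt_gen
          (fun r => r / Rpower (r ^ 2 + 2 * r * cos t + 1) ((2 + s) / 2))
          (at_point 0) (Rbar_locally p_infty))
      0 theta.

(* [theta] is only constrained on (0,1) x (-1,1). *)
Definition fractional_contact_angle (theta : R -> R -> R) : Prop :=
  forall s sigma, 0 < s < 1 -> -1 < sigma < 1 ->
    0 < theta s sigma < PI /\
    1 + sigma =
      Rpower (sin (theta s sigma)) s * (M (theta s sigma) s / M (PI / 2) s).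

Definition classical_contact_angle (sigma : R) : R := acos (- sigma).

(* Stdlib's [ln] is 0 at 0, so at sigma = 1 and sigma = -1 this agrees with
   the convention 0 log 0 = 0, i.e. with the continuous extension. *)
Definition expansion_numerator (sigma : R) : R :=
  2 * sigma * ln 2 + (1 - sigma) * ln (1 - sigma)
    - (1 + sigma) * ln (1 + sigma).

Definition strictly_convex_on (a b : R) (f : R -> R) : Prop :=
  forall x y t, a < x < b -> a < y < b -> x <> y -> 0 < t < 1 ->
    f (t * x + (1 - t) * y) < t * f x + (1 - t) * f y.

Definition strictly_concave_on (a b : R) (f : R -> R) : Prop :=
  forall x y t, a < x < b -> a < y < b -> x <> y -> 0 < t < 1 ->
    t * f x + (1 - t) * f y < f (t * x + (1 - t) * y).

(* Main.v *)
Require Import Defs.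
From Stdlib Require Import Reals Lra.
From Coquelicot Require Import Coquelicot.
Open Scope R_scope.

(** The implicit equation has an elementary form:
    [(sin theta)^s * M theta s = 2/s * A theta], where [A theta] is the integral
    of [sin^s] over [[0, theta]] ([sin_power_M]).  The contact angle is thus
    given by [A theta = (1 + sigma) * A (PI/2)].  The classical angle solves
    the same equation with [sin] as the weight, since [1 - cos theta] is the
    integral of [sin] and [1 + sigma = 1 - cos (acos (- sigma))].  The angle
    [PI/2 * (1 + sigma)] solves it with weight [1].

    For [s < 1] the ratio [sin^s / sin] is strictly decreasing on [(0, PI/2)],
    so, compared with [sin], the weight [sin^s] puts more of its mass on
    [[0, PI/2]] near [0]: for [0 < theta < PI/2],
    [A theta / A (PI/2) > 1 - cos theta].  This puts the fractional angle below
    the classical one when [sigma < 0], and the reflection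
    [theta -> PI - theta] gives the case [sigma > 0]
    ([angle_comparison]).  The argument is the same for the weights [sin^s],
    [0 < s < 1], and [1].  As it applies to every [s] in [(0, 1)], both
    thresholds in [s] can be taken to be [1/2], uniformly in [sigma].

    To get the elementary form, the inner integral over [r] is computed in terms
    of the angle [psi] with [cot psi = (r + cos t) / sin t].  Its value is
    [1/s - cos t * (sin t)^(-1-s) * A t] ([radial_integral]), which is the
    derivative in [t] of [(sin t)^(-s) * A t / s].

    The numerator in the expansion is an odd function of [sigma] whose
    derivative is [2 ln 2 - 2 - ln (1 - sigma^2)]; this increases on [(0, 1)].
*)

(** * Strict convexity of the numerator in the expansion *)

Lemma mean_value (f df : R -> R) (a b : R) :
  a < b ->
  (forall x, a <= x <= b -> is_derive f x (df x)) ->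
  exists c, a < c < b /\ f b - f a = df c * (b - a).
Proof.
intros ab Df.
destruct (MVT_cor2 f df a b ab) as [c [Ec Hc]].
  now intros c Hc; apply is_derive_Reals, Df.
now exists c.
Qed.

(** By the mean value theorem, the slopes of the two chords meeting at a point
    between [x] and [y] are values of the derivative at ordered points. *)
Lemma strictly_convex_of_increasing_derivative (a b : R) (f df : R -> R) :
  (forall x, a < x < b -> is_derive f x (df x)) ->
  (forall x y, a < x -> x < y -> y < b -> df x < df y) ->
  strictly_convex_on a b f.
Proof.
intros Df Hdf.
assert (ordered : forall x y t, a < x < b -> a < y < b -> x < y -> 0 < t < 1 ->
    f (t * x + (1 - t) * y) < t * f x + (1 - t) * f y).
  intros x y t Hx Hy xy Ht.
  set (z := t * x + (1 - t) * y).
  assert (xz : z - x = (1 - t) * (y - x)) by (unfold z; ring).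
  assert (zy : y - z = t * (y - x)) by (unfold z; ring).
  assert (0 < (1 - t) * (y - x)) by (apply Rmult_lt_0_compat; lra).
  assert (0 < t * (y - x)) by (apply Rmult_lt_0_compat; lra).
  destruct (mean_value f df x z) as [c [Hc Ec]]; [lra| |].
    intros u Hu; apply Df; lra.
  destruct (mean_value f df z y) as [d [Hd Ed]]; [lra| |].
    intros u Hu; apply Df; lra.
  assert (cd : df c < df d) by (apply Hdf; lra).
  rewrite xz in Ec; rewrite zy in Ed.
  assert (E : t * f x + (1 - t) * f y - f z
      = (df d - df c) * (t * ((1 - t) * (y - x)))).
    replace (t * f x + (1 - t) * f y - f z)
      with ((1 - t) * (f y - f z) - t * (f z - f x)) by ring.
    rewrite Ec, Ed; ring.
  assert (0 < (df d - df c) * (t * ((1 - t) * (y - x)))).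
    apply Rmult_lt_0_compat; [lra|]; apply Rmult_lt_0_compat; lra.
  lra.
intros x y t Hx Hy xy Ht.
destruct (Rlt_or_le x y) as [lt|le].
  now apply ordered.
replace (t * x + (1 - t) * y) with ((1 - t) * y + (1 - (1 - t)) * x) by ring.
replace (t * f x + (1 - t) * f y)
  with ((1 - t) * f y + (1 - (1 - t)) * f x) by ring.
apply ordered; lra.
Qed.

Lemma expansion_numerator_convex : strictly_convex_on 0 1 expansion_numerator.
Proof.
apply strictly_convex_of_increasing_derivative
  with (df := fun x => 2 * ln 2 - 2 - ln ((1 - x) * (1 + x))).
  intros x Hx; rewrite ln_mult by lra.
  unfold expansion_numerator; auto_derive; [lra|].
  replace (1 + - x) with (1 - x) by ring; field; lra.
intros x y Hx xy Hy.
assert (ln ((1 - y) * (1 + y)) < ln ((1 - x) * (1 + x))); [|lra].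
apply ln_increasing; nra.
Qed.

Lemma expansion_numerator_odd (x : R) :
  expansion_numerator (- x) = - expansion_numerator x.
Proof.
unfold expansion_numerator.
replace (1 - - x) with (1 + x) by ring.
replace (1 + - x) with (1 - x) by ring.
ring.
Qed.

Lemma expansion_numerator_concave :
  strictly_concave_on (-1) 0 expansion_numerator.
Proof.
intros x y t Hx Hy xy Ht.
assert (H := expansion_numerator_convex (- x) (- y) t).
rewrite !expansion_numerator_odd in H.
replace (t * - x + (1 - t) * - y) with (- (t * x + (1 - t) * y)) in H by ring.
rewrite expansion_numerator_odd in H.
assert (H' := H ltac:(lra) ltac:(lra) ltac:(lra) Ht); lra.
Qed.

Lemma expansion_numerator_1 : expansion_numerator 1 = 0.
Proof.
unfold expansion_numerator.
replace (1 + 1) with 2 by ring; replace (1 - 1) with 0 by ring; ring.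
Qed.

(** * Angles measured by a weight *)

(** The equation [A theta = (1 + sigma) * A (PI / 2)] says that the arc
    [[0, theta]] carries the proportion [(1 + sigma) / 2] of the mass that the
    weight [g] gives to the half circle.  The classical angle solves the
    equation for the weight [sin], and a symmetric weight that decreases
    relatively to [sin] on the first quarter concentrates more mass near the
    ends [0] and [PI], hence moves the solution away from [PI / 2]. *)
Lemma angle_comparison (A g : R -> R) (theta sigma : R) :
  A 0 = 0 ->
  (forall x, is_derive A x (g x)) ->
  (forall x, g (PI - x) = g x) ->
  (forall x, 0 < x < PI / 2 -> 0 < g x) ->
  (forall x y, 0 < x -> x < y -> y < PI / 2 -> g y / sin y < g x / sin x) ->
  0 < theta < PI ->
  A theta = (1 + sigma) * A (PI / 2) ->
  -1 < sigma < 1 ->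
  (sigma < 0 -> theta < classical_contact_angle sigma) /\
  (0 < sigma -> classical_contact_angle sigma < theta).
Proof.
intros A0 DA gsym gpos gdec.
assert (Pi := PI_RGT_0).
assert (Asym : forall x, A (PI - x) = 2 * A (PI / 2) - A x).
  intros x.
  assert (D : forall y, is_derive (fun y => A y + A (PI - y)) y 0).
    intros y; replace 0 with (plus (g y) (scal (-1) (g (PI - y)))).
      apply (is_derive_plus A (fun y => A (PI - y))); [apply DA|].
      apply (is_derive_comp A (fun y => PI - y)); [apply DA|].
      auto_derive; [easy|ring].
    rewrite gsym; unfold plus, scal; simpl; unfold mult; simpl; ring.
  assert (E : A x + A (PI - x) = A (PI / 2) + A (PI - PI / 2)).
    destruct (MVT_gen (fun y => A y + A (PI - y)) (PI / 2) x (fun _ => 0))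
      as [c [_ Ec]].
        now intros y _; apply D.
      intros y _; apply derivable_continuous_pt; exists 0.
      now apply is_derive_Reals, D.
    lra.
  replace (PI - PI / 2) with (PI / 2) in E by field; lra.
assert (Ainc : forall x y, 0 <= x -> x < y -> y <= PI / 2 -> A x < A y).
  intros x y Hx xy Hy.
  destruct (mean_value A g x y xy) as [c [Hc Ec]]; [now intros; apply DA|].
  assert (0 < g c * (y - x)) by
    (apply Rmult_lt_0_compat; [apply gpos; lra|lra]).
  lra.
assert (k0 : 0 < A (PI / 2)) by (rewrite <- A0; apply Ainc; lra).
(* The difference [D] vanishes at both ends of the quarter circle, and its
   derivative [sin y * (g y / sin y - A (PI / 2))] can only change from
   positive to negative.  If [D x <= 0], the mean value theorem on both sides
   of [x] finds the opposite change. *)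
assert (above : forall x, 0 < x < PI / 2 -> A (PI / 2) * (1 - cos x) < A x).
  intros x Hx; apply Rnot_le_lt; intros le.
  set (D := fun y => A y - A (PI / 2) * (1 - cos y)).
  assert (DD : forall y, is_derive D y (g y - A (PI / 2) * sin y)).
    intros y; unfold D.
    apply (is_derive_minus A (fun y => A (PI / 2) * (1 - cos y)) y); [apply DA|].
    auto_derive; [easy|ring].
  destruct (mean_value D _ 0 x (proj1 Hx) (fun y _ => DD y)) as [c [Hc Ec]].
  destruct (mean_value D _ x (PI / 2) (proj2 Hx) (fun y _ => DD y))
    as [d [Hd Ed]].
  unfold D in Ec, Ed; rewrite A0, cos_0 in Ec; rewrite cos_PI2 in Ed.
  assert (sc : 0 < sin c) by (apply sin_gt_0; lra).
  assert (sd : 0 < sin d) by (apply sin_gt_0; lra).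
  assert (Hcd := gdec c d ltac:(lra) ltac:(lra) ltac:(lra)).
  assert (gc : g c - A (PI / 2) * sin c <= 0) by nra.
  assert (gd : 0 <= g d - A (PI / 2) * sin d) by nra.
  assert (g c / sin c <= A (PI / 2)).
    apply Rmult_le_reg_r with (sin c); [easy|].
    unfold Rdiv; rewrite Rmult_assoc, Rinv_l; lra.
  assert (A (PI / 2) <= g d / sin d).
    apply Rmult_le_reg_r with (sin d); [easy|].
    unfold Rdiv; rewrite Rmult_assoc, Rinv_l; lra.
  lra.
intros Ht Et Hs.
assert (bnd := acos_bound (- sigma)).
assert (Ea : cos (acos (- sigma)) = - sigma) by (apply cos_acos; lra).
unfold classical_contact_angle; split; intros Hs0.
- assert (lt : theta < PI / 2).
    apply Rnot_le_lt; intros le.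
    assert (le' : A (PI - theta) <= A (PI / 2)).
      destruct (Req_dec theta (PI / 2)) as [->|ne].
        replace (PI - PI / 2) with (PI / 2) by field; lra.
      apply Rlt_le, Ainc; lra.
    rewrite Asym in le'; nra.
  apply cos_decreasing_0; try lra.
  rewrite Ea; assert (ab := above theta ltac:(lra)); nra.
- assert (lt : PI / 2 < theta).
    apply Rnot_le_lt; intros le.
    assert (le' : A theta <= A (PI / 2)).
      destruct (Req_dec theta (PI / 2)) as [->|ne]; [lra|].
      apply Rlt_le, Ainc; lra.
    nra.
  apply cos_decreasing_0; try lra.
  rewrite Ea; assert (ab := above (PI - theta) ltac:(lra)).
  rewrite Asym, Rtrigo_facts.cos_pi_minus in ab; nra.
Qed.

(** The angle [PI / 2 * (1 + sigma)] divides the half circle in the proportion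
    prescribed by [sigma] for the constant weight. *)
Lemma half_circle_comparison (sigma : R) :
  -1 < sigma < 1 ->
  (sigma < 0 -> PI / 2 * (1 + sigma) < classical_contact_angle sigma) /\
  (0 < sigma -> classical_contact_angle sigma < PI / 2 * (1 + sigma)).
Proof.
intros Hs; assert (Pi := PI_RGT_0).
apply (angle_comparison (fun x => x) (fun _ => 1)); try easy.
- now intros x; auto_derive.
- intros; lra.
- intros x y Hx xy Hy.
  assert (sin x < sin y) by (apply sin_increasing_1; lra).
  assert (0 < sin x) by (apply sin_gt_0; lra).
  unfold Rdiv; rewrite !Rmult_1_l; apply Rinv_lt_contravar; [nra|easy].
- nra.
- lra.
Qed.

(** * Powers of the sine *)

(** [Rpower 0 s] is [1]; setting the power to [0] outside the positive reals
    makes [sin^s] continuous on the whole line, so that its integral is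
    everywhere differentiable. *)
Definition pos_power (s x : R) : R := if Rlt_dec 0 x then Rpower x s else 0.

Lemma pos_power_pos (s x : R) : 0 < x -> pos_power s x = Rpower x s.
Proof. intros Hx; unfold pos_power; destruct (Rlt_dec 0 x); lra. Qed.

Lemma Rpower_gt_0 (x a : R) : 0 < Rpower x a.
Proof. apply exp_pos. Qed.

Lemma is_derive_Rpower (a x : R) :
  0 < x -> is_derive (fun y => Rpower y a) x (a * Rpower x (a - 1)).
Proof. intros Hx; now apply is_derive_Reals, derivable_pt_lim_power. Qed.

Lemma locally_gt (a x : R) : a < x -> locally x (fun y => a < y).
Proof.
intros ax; apply (locally_interval _ x a p_infty); simpl; auto.
Qed.

Lemma locally_lt (x b : R) : x < b -> locally x (fun y => y < b).
Proof.
intros ax; apply (locally_interval _ x m_infty b); simpl; auto.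
Qed.

Lemma continuous_of_derive (f : R -> R) (x l : R) :
  is_derive f x l -> continuous f x.
Proof.
intros D; apply (ex_derive_continuous f); now exists l.
Qed.

Lemma continuous_pos_power (s x : R) : 0 < s -> continuous (pos_power s) x.
Proof.
intros Hs; destruct (Rtotal_order x 0) as [neg|[->|pos]].
- apply continuous_ext_loc with (fun _ => 0); [|apply continuous_const].
  apply filter_imp with (2 := locally_lt x 0 neg); intros y Hy.
  unfold pos_power; destruct (Rlt_dec 0 y); lra.
- apply filterlim_locally; intros [e He]; simpl.
  exists (mkposreal (Rpower e (/ s)) (Rpower_gt_0 _ _)); intros y Hy.
  change (Rabs (y - 0) < Rpower e (/ s)) in Hy.
  change (Rabs (pos_power s y - pos_power s 0) < e).
  unfold pos_power at 2; destruct (Rlt_dec 0 0); [lra|].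
  unfold pos_power; destruct (Rlt_dec 0 y) as [py|ny].
    rewrite Rminus_0_r in *; rewrite Rabs_pos_eq in Hy by lra.
    rewrite Rabs_pos_eq by (apply Rlt_le, Rpower_gt_0).
    replace e with (Rpower (Rpower e (/ s)) s).
      now apply Rlt_Rpower_l.
    rewrite Rpower_mult, Rinv_l, Rpower_1; lra.
  now rewrite Rminus_0_r, Rabs_R0.
- apply continuous_ext_loc with (fun y => Rpower y s).
    apply filter_imp with (2 := locally_gt 0 x pos); intros y Hy.
    now rewrite pos_power_pos.
  now apply continuous_of_derive with (1 := is_derive_Rpower s x pos).
Qed.

Definition sine_mass (s x : R) : R :=
  RInt (fun u => pos_power s (sin u)) 0 x.

Lemma sine_mass_0 (s : R) : sine_mass s 0 = 0.
Proof. unfold sine_mass; now rewrite RInt_point. Qed.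

Lemma is_derive_sine_mass (s x : R) :
  0 < s -> is_derive (sine_mass s) x (pos_power s (sin x)).
Proof.
intros Hs.
assert (C : forall u, continuous (fun u => pos_power s (sin u)) u).
  intros u; apply (continuous_comp sin (pos_power s)).
    now apply continuous_sin.
  now apply continuous_pos_power.
apply (is_derive_RInt (fun u => pos_power s (sin u)) (sine_mass s) 0 x); auto.
apply filter_forall; intros y.
apply (RInt_correct (V := R_CompleteNormedModule)).
now apply (ex_RInt_continuous (V := R_CompleteNormedModule)).
Qed.

Lemma continuous_sine_mass (s x : R) : 0 < s -> continuous (sine_mass s) x.
Proof.
intros Hs; now apply continuous_of_derive with (1 := is_derive_sine_mass s x Hs).
Qed.

(** Here [sin^s / sin] is [1 / sin^(1 - s)], which decreases because [s < 1]. *)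
Lemma sine_mass_comparison (s theta sigma : R) :
  0 < s < 1 ->
  0 < theta < PI ->
  sine_mass s theta = (1 + sigma) * sine_mass s (PI / 2) ->
  -1 < sigma < 1 ->
  (sigma < 0 -> theta < classical_contact_angle sigma) /\
  (0 < sigma -> classical_contact_angle sigma < theta).
Proof.
intros Hs; assert (Pi := PI_RGT_0).
apply (angle_comparison (sine_mass s) (fun x => pos_power s (sin x))).
- apply sine_mass_0.
- intros x; apply is_derive_sine_mass; lra.
- now intros x; rewrite Rtrigo_facts.sin_pi_minus.
- intros x Hx; rewrite pos_power_pos by (apply sin_gt_0; lra).
  apply Rpower_gt_0.
- assert (E : forall x, 0 < x -> pos_power s x / x = / Rpower x (1 - s)).
    intros x Hx; rewrite pos_power_pos by easy.
    rewrite <- Rpower_Ropp; replace (- (1 - s)) with (s + - (1)) by ring.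
    rewrite Rpower_plus, Rpower_Ropp, Rpower_1; easy.
  intros x y Hx xy Hy.
  assert (sin x < sin y) by (apply sin_increasing_1; lra).
  assert (0 < sin x) by (apply sin_gt_0; lra).
  rewrite !E by lra.
  apply Rinv_lt_contravar.
    apply Rmult_lt_0_compat; apply Rpower_gt_0.
  apply Rlt_Rpower_l; lra.
Qed.

(** * The radial integral *)

(** The value [1 / (1 + s)] is the limit at [0+] of
    [(sin t)^(-1-s) * sine_mass s t]: near [0] the mass behaves like
    [t^(1+s) / (1 + s)].  With it, the radial integral as a function of [t]
    extends continuously to the end point [0] of the polar integral. *)
Definition sine_ratio (s t : R) : R :=
  if Rlt_dec 0 t then sine_mass s t * Rpower (sin t) (-1 - s) else / (1 + s).

Lemma sine_ratio_pos (s t : R) :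
  0 < t -> sine_ratio s t = sine_mass s t * Rpower (sin t) (-1 - s).
Proof. intros Ht; unfold sine_ratio; destruct (Rlt_dec 0 t); lra. Qed.

Section Radial.

Variables (s t : R).
Hypotheses (Hs : 0 < s) (Ht : 0 < t < PI).

Let q (r : R) := r ^ 2 + 2 * r * cos t + 1.

Let S0 : 0 < sin t.
Proof. apply sin_gt_0; lra. Qed.

Let q_square (r : R) : q r = (r + cos t) ^ 2 + sin t ^ 2.
Proof.
unfold q; assert (H := sin2_cos2 t); unfold Rsqr in H; nra.
Qed.

Let q0 (r : R) : 0 < q r.
Proof.
rewrite q_square.
assert (H1 := pow2_ge_0 (r + cos t)); assert (H2 := pow_lt (sin t) 2 S0); lra.
Qed.

(** The angle whose cotangent is [(r + cos t) / sin t]. Geometrically, with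
    [t] the polar angle of a point at distance [r] from the origin, it is the
    direction of that point seen from [(-1, 0)], measured from the ray of
    angle [t].  It decreases from [t] to [0] as [r] goes from [0] to
    infinity. *)
Let angle (r : R) := PI / 2 - atan ((r + cos t) / sin t).

Let angle_0 : angle 0 = t.
Proof.
unfold angle; rewrite Rplus_0_l.
replace (cos t / sin t) with (tan (PI / 2 - t)).
  rewrite atan_tan; lra.
unfold tan; now rewrite sin_shift, cos_shift.
Qed.

Let sin_angle (r : R) : sin (angle r) = sin t * Rpower (q r) (- / 2).
Proof.
unfold angle; rewrite sin_shift, cos_atan.
rewrite Rpower_Ropp, Rpower_sqrt by apply q0.
assert (E : 1 + ((r + cos t) / sin t)² = q r / sin t ^ 2).
  rewrite q_square; unfold Rsqr; field; lra.
rewrite E, sqrt_div_alt by nra.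
rewrite sqrt_pow2 by lra.
assert (0 < sqrt (q r)) by (apply sqrt_lt_R0, q0).
field; split; lra.
Qed.

Let is_derive_angle (r : R) : is_derive angle r (- (sin t / q r)).
Proof.
assert (D : is_derive angle r
  (- (/ sin t * / (1 + ((r + cos t) / sin t)²)))).
  apply is_derive_Reals; unfold angle.
  apply is_derive_Reals.
  evar_last.
    apply (is_derive_minus (fun _ => PI / 2)
             (fun r => atan ((r + cos t) / sin t))).
      apply is_derive_const.
    apply (is_derive_comp atan (fun r => (r + cos t) / sin t)).
      apply is_derive_atan.
    instantiate (1 := / sin t).
    auto_derive; [easy|field; lra].
  unfold minus, plus, opp, zero, scal; simpl; unfold mult; simpl; ring.
replace (- (sin t / q r)) with (- (/ sin t * / (1 + ((r + cos t) / sin t)²)));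
  [easy|].
assert (H := q0 r); rewrite q_square in H |- *.
unfold Rsqr; field; repeat split; nra.
Qed.

(** The numerator is split as [r = (r + cos t) - cos t].  The first part is
    half the derivative of [q] and integrates to a power of [q].  The second
    one becomes a multiple of the integral of [sin^s] in the variable [angle],
    because [sin (angle r) = sin t / sqrt (q r)] and
    [angle' = - sin t / q]. *)
Let primitive (r : R) :=
  - / s * Rpower (q r) (- (s / 2))
  + cos t * Rpower (sin t) (-1 - s) * sine_mass s (angle r).

Let integrand (r : R) := r / Rpower (q r) ((2 + s) / 2).

Let is_derive_primitive (r : R) : is_derive primitive r (integrand r).
Proof.
unfold primitive; evar_last.
  apply (is_derive_plus (fun r => - / s * Rpower (q r) (- (s / 2)))
    (fun r => cos t * Rpower (sin t) (-1 - s) * sine_mass s (angle r))).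
    apply is_derive_scal.
    apply (is_derive_comp (fun x => Rpower x (- (s / 2))) q).
      apply is_derive_Rpower, q0.
    instantiate (1 := 2 * (r + cos t)).
    unfold q; auto_derive; [easy|ring].
  apply is_derive_scal.
  apply (is_derive_comp (sine_mass s) angle).
    now apply is_derive_sine_mass.
  apply is_derive_angle.
unfold integrand, plus, scal; simpl; unfold mult; simpl.
rewrite sin_angle, pos_power_pos
  by (apply Rmult_lt_0_compat; [easy|apply Rpower_gt_0]).
rewrite <- Rpower_mult_distr by (easy || apply Rpower_gt_0).
rewrite Rpower_mult.
assert (Q0 := q0 r).
set (e := - ((2 + s) / 2)).
replace (r / Rpower (q r) ((2 + s) / 2)) with (r * Rpower (q r) e)
  by (unfold e; now rewrite Rpower_Ropp).
replace (- (s / 2) - 1) with e by (unfold e; field).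
assert (E1 : Rpower (q r) (- / 2 * s) = q r * Rpower (q r) e).
  rewrite <- (Rpower_1 (q r)) at 2 by easy.
  rewrite <- Rpower_plus; f_equal; unfold e; field.
assert (E2 : Rpower (sin t) (-1 - s) * Rpower (sin t) s = / sin t).
  rewrite <- Rpower_plus; replace (-1 - s + s) with (- (1)) by ring.
  rewrite Rpower_Ropp, Rpower_1; easy.
rewrite E1.
transitivity ((r + cos t) * Rpower (q r) e
  - cos t * (Rpower (sin t) (-1 - s) * Rpower (sin t) s) * sin t
    * Rpower (q r) e).
  field; lra.
rewrite E2; field; lra.
Qed.

Let continuous_integrand (r : R) : continuous integrand r.
Proof.
unfold integrand.
apply continuous_ext with (fun r => r * Rpower (q r) (- ((2 + s) / 2))).
  now intros x; rewrite Rpower_Ropp.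
apply (continuous_mult (K := R_AbsRing) (fun r => r)
         (fun r => Rpower (q r) (- ((2 + s) / 2)))).
  apply continuous_id.
apply (continuous_comp q (fun x => Rpower x (- ((2 + s) / 2)))).
  apply continuous_of_derive with (2 * (r + cos t)).
  unfold q; auto_derive; [easy|ring].
apply continuous_of_derive with (1 := is_derive_Rpower _ _ (q0 r)).
Qed.

Let primitive_0 : primitive 0 = - / s + cos t * sine_ratio s t.
Proof.
unfold primitive; rewrite angle_0, sine_ratio_pos by lra.
replace (q 0) with 1 by (unfold q; ring).
unfold Rpower at 1; rewrite ln_1, Rmult_0_r, exp_0; ring.
Qed.

Let primitive_infinity :
  filterlim primitive (Rbar_locally p_infty) (locally 0).
Proof.
assert (Lq : is_lim q p_infty p_infty).
  apply is_lim_le_p_loc with (fun r => r).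
    exists 3; intros r Hr; unfold q.
    assert (B := COS_bound t); nra.
  apply is_lim_id.
assert (Lsum : is_lim (fun r => r + cos t) p_infty p_infty).
  apply is_lim_le_p_loc with (fun r => r + -1).
    exists 0; intros r Hr; assert (B := COS_bound t); lra.
  eapply is_lim_plus; [apply is_lim_id|apply is_lim_const|easy].
assert (L1 : is_lim (fun r => Rpower (q r) (- (s / 2))) p_infty 0).
  unfold Rpower.
  apply (is_lim_comp exp (fun r => - (s / 2) * ln (q r)) p_infty 0 m_infty).
      apply is_lim_exp_m.
    evar_last.
      apply is_lim_scal_l.
      apply (is_lim_comp ln q p_infty p_infty p_infty); [|exact Lq|].
        apply is_lim_ln_p.
      now exists 0.
    simpl; destruct (Rle_dec 0 (- (s / 2))); [exfalso; lra|easy].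
  now exists 0.
assert (L2 : is_lim (fun r => sine_mass s (angle r)) p_infty 0).
  apply is_lim_ext_loc
    with (fun r => sine_mass s (atan (sin t * / (r + cos t)))).
    exists 2; intros r Hr; unfold angle.
    assert (B := COS_bound t).
    rewrite <- atan_inv by (apply Rdiv_lt_0_compat; lra).
    do 2 f_equal; field; lra.
  apply (filterlim_comp _ _ _ (fun r => sin t * / (r + cos t))
           (fun x => sine_mass s (atan x)) _ (locally 0)).
    change (is_lim (fun r => sin t * / (r + cos t)) p_infty 0).
    evar_last.
      apply is_lim_scal_l.
      apply is_lim_inv; [exact Lsum|easy].
    simpl; now rewrite Rmult_0_r.
  assert (C : continuous (fun x => sine_mass s (atan x)) 0).
    apply (continuous_comp atan (sine_mass s)).
      apply continuous_of_derive with (1 := is_derive_atan 0).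
    now apply continuous_sine_mass.
  unfold continuous in C; now rewrite atan_0, sine_mass_0 in C.
change (is_lim primitive p_infty 0).
unfold primitive; evar_last.
  eapply is_lim_plus.
      apply is_lim_scal_l, L1.
    apply is_lim_scal_l, L2.
  easy.
simpl; f_equal; ring.
Qed.

Lemma radial_integral :
  RInt_gen (fun r => r / Rpower (r ^ 2 + 2 * r * cos t + 1) ((2 + s) / 2))
    (at_point 0) (Rbar_locally p_infty)
  = / s - cos t * sine_ratio s t.
Proof.
apply is_RInt_gen_unique.
replace (/ s - cos t * sine_ratio s t) with (0 - primitive 0)
  by (rewrite primitive_0; ring).
apply is_RInt_gen_ext with (Derive primitive).
  apply filter_forall; intros ab r _.
  apply is_derive_unique, is_derive_primitive.
apply is_RInt_gen_Derive.
- apply filter_forall; intros ab r _; eexists; apply is_derive_primitive.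
- apply filter_forall; intros ab r _.
  apply continuous_ext with integrand; [|easy].
  intros x; symmetry; apply is_derive_unique, is_derive_primitive.
- intros P HP; exact (locally_singleton _ _ HP).
- exact primitive_infinity.
Qed.

End Radial.

(** * The polar integral *)

Lemma nondecreasing_of_derivative (f df : R -> R) (a b : R) :
  a <= b ->
  (forall x, a < x < b -> is_derive f x (df x)) ->
  (forall x, a <= x <= b -> continuous f x) ->
  (forall x, a <= x <= b -> 0 <= df x) ->
  f a <= f b.
Proof.
intros ab Df Cf pos.
destruct (MVT_gen f a b df) as [c [Hc Ec]];
  rewrite ?Rmin_left, ?Rmax_right in * by easy.
- exact Df.
- intros x Hx; now apply continuity_pt_filterlim, Cf.
- assert (0 <= df c * (b - a)) by (apply Rmult_le_pos; [now apply pos|lra]).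
  lra.
Qed.

Lemma pos_power_ge_0 (s x : R) : 0 <= pos_power s x.
Proof.
unfold pos_power; destruct (Rlt_dec 0 x); [apply Rlt_le, Rpower_gt_0|lra].
Qed.

Lemma sine_mass_ge_0 (s x : R) : 0 < s -> 0 <= x -> 0 <= sine_mass s x.
Proof.
intros Hs Hx; rewrite <- (sine_mass_0 s) at 1.
apply nondecreasing_of_derivative with (fun x => pos_power s (sin x)).
- easy.
- intros; now apply is_derive_sine_mass.
- intros; now apply continuous_sine_mass.
- intros; apply pos_power_ge_0.
Qed.

Lemma is_derive_sin_power (a x : R) :
  0 < x < PI ->
  is_derive (fun y => pos_power (1 + a) (sin y)) x
    ((1 + a) * pos_power a (sin x) * cos x).
Proof.
intros Hx; assert (S0 : 0 < sin x) by (apply sin_gt_0; lra).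
apply (is_derive_ext_loc (fun y => Rpower (sin y) (1 + a))).
  apply (locally_interval _ x 0 PI); try (simpl; lra).
  simpl; intros y Hy1 Hy2; now rewrite pos_power_pos by (apply sin_gt_0; lra).
rewrite pos_power_pos by easy.
evar_last.
  apply (is_derive_comp (fun z => Rpower z (1 + a)) sin).
    now apply is_derive_Rpower.
  apply is_derive_sin.
unfold scal; simpl; unfold mult; simpl.
replace (1 + a - 1) with a by ring; ring.
Qed.

(** These bounds determine the limit of [sine_ratio] at [0+].  Cleared of
    denominators, they say that [(sin t)^(1+s)] lies between
    [(1 + s) * cos t * sine_mass s t] and [(1 + s) * sine_mass s t].  As its
    derivative is [(1 + s) * (sin t)^s * cos t], both differences have
    nonnegative derivatives, and they vanish at [0]. *)
Lemma sine_ratio_bounds (s t : R) :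
  0 < s -> 0 < t < PI / 2 ->
  / (1 + s) <= sine_ratio s t <= / (1 + s) * / cos t.
Proof.
intros Hs Ht; assert (Pi := PI_RGT_0).
assert (S0 : 0 < sin t) by (apply sin_gt_0; lra).
assert (C0 : 0 < cos t) by (apply cos_gt_0; lra).
assert (Cp : forall x, continuous (fun x => pos_power (1 + s) (sin x)) x).
  intros x; apply (continuous_comp sin (pos_power (1 + s))).
    apply continuous_sin.
  apply continuous_pos_power; lra.
assert (P0 : pos_power (1 + s) (sin 0) = 0).
  rewrite sin_0; unfold pos_power; destruct (Rlt_dec 0 0); lra.
assert (low : 0 <= (1 + s) * sine_mass s t - pos_power (1 + s) (sin t)).
  replace 0 with ((1 + s) * sine_mass s 0 - pos_power (1 + s) (sin 0)) at 1
    by (rewrite sine_mass_0, P0; ring).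
  apply (nondecreasing_of_derivative
    (fun x => (1 + s) * sine_mass s x - pos_power (1 + s) (sin x))
    (fun x => (1 + s) * pos_power s (sin x) * (1 - cos x))); [lra| | |].
  - intros x Hx; evar_last.
      apply (is_derive_minus (fun x => (1 + s) * sine_mass s x)
               (fun x => pos_power (1 + s) (sin x))).
        now apply is_derive_scal, is_derive_sine_mass.
      apply is_derive_sin_power; lra.
    unfold minus, plus, opp; simpl; ring.
  - intros x _; apply (continuous_minus (V := R_NormedModule)
      (fun x => (1 + s) * sine_mass s x)); [|apply Cp].
    apply (continuous_mult (K := R_AbsRing) (fun _ => 1 + s)).
      apply continuous_const.
    now apply continuous_sine_mass.
  - intros x _; assert (B := COS_bound x); assert (H := pos_power_ge_0 s (sin x)).
    repeat apply Rmult_le_pos; lra.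
assert (up : 0 <= pos_power (1 + s) (sin t) - (1 + s) * (cos t * sine_mass s t)).
  replace 0 with
      (pos_power (1 + s) (sin 0) - (1 + s) * (cos 0 * sine_mass s 0)) at 1
    by (rewrite sine_mass_0, P0; ring).
  apply (nondecreasing_of_derivative
    (fun x => pos_power (1 + s) (sin x) - (1 + s) * (cos x * sine_mass s x))
    (fun x => (1 + s) * (sin x * sine_mass s x))); [lra| | |].
  - intros x Hx; evar_last.
      apply (is_derive_minus (fun x => pos_power (1 + s) (sin x))
               (fun x => (1 + s) * (cos x * sine_mass s x))).
        apply is_derive_sin_power; lra.
      apply is_derive_scal.
      apply (is_derive_mult cos (sine_mass s)).
          apply is_derive_cos.
        now apply is_derive_sine_mass.
      intros; apply Rmult_comm.
    unfold minus, plus, opp, mult; simpl; ring.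
  - intros x _; apply (continuous_minus (V := R_NormedModule)
      (fun x => pos_power (1 + s) (sin x))); [apply Cp|].
    apply (continuous_mult (K := R_AbsRing) (fun _ => 1 + s)).
      apply continuous_const.
    apply (continuous_mult (K := R_AbsRing) cos).
      apply continuous_cos.
    now apply continuous_sine_mass.
  - intros x Hx; assert (H := sine_mass_ge_0 s x Hs (proj1 Hx)).
    assert (0 <= sin x) by (apply sin_ge_0; lra).
    repeat apply Rmult_le_pos; lra.
rewrite sine_ratio_pos by lra; rewrite pos_power_pos in low, up by easy.
replace (-1 - s) with (- (1 + s)) by ring; rewrite Rpower_Ropp.
assert (p0 := Rpower_gt_0 (sin t) (1 + s)).
set (p := Rpower (sin t) (1 + s)) in *.
split.
- apply Rmult_le_reg_l with ((1 + s) * p); [nra|].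
  field_simplify; lra.
- apply Rmult_le_reg_l with ((1 + s) * p * cos t).
    repeat apply Rmult_lt_0_compat; lra.
  field_simplify; lra.
Qed.

Lemma continuous_sine_ratio (s t : R) :
  0 < s -> t < PI -> continuous (sine_ratio s) t.
Proof.
intros Hs Ht; assert (Pi := PI_RGT_0).
destruct (Rtotal_order t 0) as [neg|[->|pos]].
- apply continuous_ext_loc with (fun _ => / (1 + s)); [|apply continuous_const].
  apply filter_imp with (2 := locally_lt t 0 neg); intros y Hy.
  unfold sine_ratio; destruct (Rlt_dec 0 y); lra.
- assert (E0 : sine_ratio s 0 = / (1 + s)).
    unfold sine_ratio; destruct (Rlt_dec 0 0); lra.
  assert (i0 : 0 < / (1 + s)) by (apply Rinv_0_lt_compat; lra).
  assert (Cu : continuous (fun x => / (1 + s) * / cos x) 0).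
    apply (ex_derive_continuous (fun x => / (1 + s) * / cos x)).
    auto_derive; rewrite cos_0; lra.
  unfold continuous in *; rewrite cos_0, Rinv_1, Rmult_1_r in Cu; rewrite E0.
  apply filterlim_locally; intros e.
  apply (filter_imp (fun x => Rabs (/ (1 + s) * / cos x - / (1 + s)) < e
    /\ (- (PI / 2) < x /\ x < PI / 2))).
    intros x [He Hx].
    change (Rabs (sine_ratio s x - / (1 + s)) < e).
    destruct (Rlt_or_le 0 x) as [px|nx].
      assert (B := sine_ratio_bounds s x Hs ltac:(lra)).
      rewrite Rabs_pos_eq in * by lra; lra.
    unfold sine_ratio; destruct (Rlt_dec 0 x); [lra|].
    rewrite Rminus_diag, Rabs_R0; apply cond_pos.
  apply filter_and.
    apply (proj1 (filterlim_locally _ _) Cu e).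
  apply filter_and; [apply locally_gt; lra|apply locally_lt; lra].
- assert (S0 : 0 < sin t) by (apply sin_gt_0; lra).
  apply continuous_ext_loc
    with (fun x => sine_mass s x * Rpower (sin x) (-1 - s)).
    apply filter_imp with (2 := locally_gt 0 t pos); intros y Hy.
    now rewrite sine_ratio_pos.
  apply (continuous_mult (K := R_AbsRing) (sine_mass s)).
    now apply continuous_sine_mass.
  apply (continuous_comp sin (fun x => Rpower x (-1 - s))).
    apply continuous_sin.
  apply continuous_of_derive with (1 := is_derive_Rpower _ _ S0).
Qed.

(** A fundamental theorem of calculus in which [F] need not be differentiable
    at the end points: the primitive of the radial integral is extended by
    its limit at [0], where it is only known to be continuous. *)
Lemma RInt_of_interior_derivative (f F : R -> R) (a b c : R) :
  a <= b -> b < c ->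
  (forall x, x < c -> continuous f x) ->
  (forall x, x < c -> continuous F x) ->
  (forall x, a < x < b -> is_derive F x (f x)) ->
  RInt f a b = F b - F a.
Proof.
intros ab bc Cf CF DF.
assert (DR : forall x, x < c -> is_derive (RInt f a) x (f x)).
  intros x Hx; apply (is_derive_RInt f (RInt f a) a x); [|now apply Cf].
  apply filter_imp with (2 := locally_lt x c Hx); intros y Hy.
  apply (RInt_correct (V := R_CompleteNormedModule)).
  apply (ex_RInt_continuous (V := R_CompleteNormedModule)); intros z Hz.
  apply Cf, Rle_lt_trans with (1 := proj2 Hz), Rmax_lub_lt; lra.
destruct (MVT_gen (fun x => RInt f a x - F x) a b (fun _ => 0))
  as [d [_ Ed]]; rewrite ?Rmin_left, ?Rmax_right by easy.
- intros x Hx; replace 0 with (minus (f x) (f x)) by apply Rminus_diag.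
  apply (is_derive_minus (RInt f a) F); [apply DR; lra|now apply DF].
- intros x Hx; apply continuity_pt_filterlim.
  apply (continuous_minus (V := R_NormedModule) (RInt f a) F).
    apply continuous_of_derive with (f x), DR; lra.
  apply CF; lra.
- rewrite RInt_point in Ed; unfold zero in Ed; simpl in Ed; lra.
Qed.

(** Since [((sin t)^(-s))' = - s * cos t * (sin t)^(-1-s)], the radial integral
    [1/s - cos t * (sin t)^(-1-s) * sine_mass s t] is the derivative of
    [(sin t)^(-s) * sine_mass s t / s], which is
    [sin t * sine_ratio s t / s] and vanishes at [0]. *)
Lemma sin_power_M (s theta : R) :
  0 < s -> 0 < theta < PI ->
  Rpower (sin theta) s * M theta s = 2 / s * sine_mass s theta.
Proof.
intros Hs Ht.
assert (S0 : forall x, 0 < x < PI -> 0 < sin x) by (intros; apply sin_gt_0; lra).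
assert (E : M theta s = 2 * (sin theta * sine_ratio s theta / s)).
  unfold M; f_equal.
  rewrite (RInt_ext _ (fun t => / s - cos t * sine_ratio s t)).
    rewrite (RInt_of_interior_derivative _
      (fun x => sin x * sine_ratio s x / s) 0 theta PI); try lra.
    - rewrite sin_0; unfold Rdiv; rewrite !Rmult_0_l; apply Rminus_0_r.
    - intros x Hx; apply (continuous_minus (V := R_NormedModule) (fun _ => / s)).
        apply continuous_const.
      apply (continuous_mult (K := R_AbsRing) cos); [apply continuous_cos|].
      now apply continuous_sine_ratio.
    - intros x Hx.
      apply (continuous_mult (K := R_AbsRing) (fun x => sin x * sine_ratio s x)
               (fun _ => / s)); [|apply continuous_const].
      apply (continuous_mult (K := R_AbsRing) sin); [apply continuous_sin|].
      now apply continuous_sine_ratio.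
    - intros x Hx; assert (Sx := S0 x ltac:(lra)).
      apply (is_derive_ext_loc
        (fun y => / s * (sine_mass s y * Rpower (sin y) (- s)))).
        apply (locally_interval _ x 0 PI); try (simpl; lra).
        simpl; intros y Hy1 Hy2; assert (Sy := S0 y ltac:(lra)).
        rewrite sine_ratio_pos by lra.
        replace (- s) with (1 + (-1 - s)) by ring.
        rewrite Rpower_plus, Rpower_1 by easy; field; lra.
      evar_last.
        apply is_derive_scal.
        apply (is_derive_mult (sine_mass s) (fun y => Rpower (sin y) (- s))).
            now apply is_derive_sine_mass.
          apply (is_derive_comp (fun z => Rpower z (- s)) sin).
            now apply is_derive_Rpower.
          apply is_derive_sin.
        intros; apply Rmult_comm.
      unfold plus, scal, mult; simpl; unfold mult; simpl.
      rewrite sine_ratio_pos, pos_power_pos by (lra || easy).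
      replace (- s - 1) with (-1 - s) by ring.
      assert (H : Rpower (sin x) s * Rpower (sin x) (- s) = 1).
        rewrite <- Rpower_plus, Rplus_opp_r; now apply Rpower_O.
      rewrite Rmult_plus_distr_l, H; field; lra.
  rewrite Rmin_left, Rmax_right by lra; intros t Ht'.
  apply radial_integral; lra.
assert (Sx := S0 theta Ht).
rewrite E, sine_ratio_pos by lra.
assert (H : Rpower (sin theta) s * sin theta * Rpower (sin theta) (-1 - s) = 1).
  rewrite <- (Rpower_1 (sin theta)) at 2 by easy.
  rewrite <- !Rpower_plus; replace (s + 1 + (-1 - s)) with 0 by ring.
  now apply Rpower_O.
transitivity (2 / s * sine_mass s theta * (Rpower (sin theta) s * sin theta
  * Rpower (sin theta) (-1 - s))).
  field; lra.
rewrite H; ring.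
Qed.

Lemma contact_angle_mass (s theta sigma : R) :
  0 < s -> 0 < theta < PI ->
  1 + sigma = Rpower (sin theta) s * (M theta s / M (PI / 2) s) ->
  sine_mass s theta = (1 + sigma) * sine_mass s (PI / 2).
Proof.
intros Hs Ht E; assert (Pi := PI_RGT_0).
assert (H := sin_power_M s theta Hs Ht).
assert (H2 := sin_power_M s (PI / 2) Hs ltac:(lra)).
rewrite sin_PI2 in H2.
unfold Rpower at 1 in H2; rewrite ln_1, Rmult_0_r, exp_0, Rmult_1_l in H2.
assert (k0 : 0 < sine_mass s (PI / 2)).
  destruct (mean_value (sine_mass s) (fun x => pos_power s (sin x)) 0 (PI / 2))
    as [c [Hc Ec]]; [lra|intros; now apply is_derive_sine_mass|].
  rewrite sine_mass_0 in Ec.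
  assert (0 < pos_power s (sin c) * (PI / 2 - 0)); [|lra].
  apply Rmult_lt_0_compat; [|lra].
  rewrite pos_power_pos by (apply sin_gt_0; lra); apply Rpower_gt_0.
rewrite E, H2.
replace (Rpower (sin theta) s * (M theta s / (2 / s * sine_mass s (PI / 2)))
    * sine_mass s (PI / 2))
  with (Rpower (sin theta) s * M theta s * (s / 2)) by (field; lra).
rewrite H; field; lra.
Qed.

Lemma fractional_classical_comparison (theta : R -> R -> R) (s sigma : R) :
  fractional_contact_angle theta ->
  0 < s < 1 -> -1 < sigma < 1 ->
  (sigma < 0 -> theta s sigma < classical_contact_angle sigma) /\
  (0 < sigma -> classical_contact_angle sigma < theta s sigma).
Proof.
intros Htheta Hs Hsigma; destruct (Htheta s sigma Hs Hsigma) as [Ht E].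
apply sine_mass_comparison with s; try easy.
apply contact_angle_mass; easy.
Qed.

(** * The main result *)

Theorem mainTheorem2 (theta : R -> R -> R)
    (Htheta : fractional_contact_angle theta) :
  strictly_concave_on (-1) 0 expansion_numerator /\
  strictly_convex_on 0 1 expansion_numerator /\
  expansion_numerator 0 = 0 /\
  expansion_numerator 1 = 0 /\
  expansion_numerator (-1) = 0 /\
  (exists s1, 0 < s1 < 1 /\ forall s, s1 < s < 1 ->
     (forall sigma, -1 < sigma < 0 ->
        theta s sigma < classical_contact_angle sigma) /\
     (forall sigma, 0 < sigma < 1 ->
        theta s sigma > classical_contact_angle sigma)) /\
  (forall sigma, -1 < sigma < 0 ->
     PI / 2 * (1 + sigma) < classical_contact_angle sigma) /\
  (forall sigma, 0 < sigma < 1 ->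
     PI / 2 * (1 + sigma) > classical_contact_angle sigma) /\
  (exists s0, 0 < s0 < 1 /\ forall s, 0 < s < s0 ->
     (forall sigma, -1 < sigma < 0 ->
        theta s sigma < classical_contact_angle sigma) /\
     (forall sigma, 0 < sigma < 1 ->
        theta s sigma > classical_contact_angle sigma)).
Proof.
assert (comparison : forall s, 0 < s < 1 ->
    (forall sigma, -1 < sigma < 0 ->
       theta s sigma < classical_contact_angle sigma) /\
    (forall sigma, 0 < sigma < 1 ->
       theta s sigma > classical_contact_angle sigma)).
  intros s Hs; split; intros sigma Hsigma;
    apply (fractional_classical_comparison theta); easy || lra.
split; [exact expansion_numerator_concave|].
split; [exact expansion_numerator_convex|].
split; [unfold expansion_numerator; rewrite Rminus_0_r, Rplus_0_r; ring|].
split; [exact expansion_numerator_1|].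
split.
  replace (-1) with (- (1)) by ring.
  rewrite expansion_numerator_odd, expansion_numerator_1; ring.
split; [exists (1 / 2); split; [lra|]; intros; apply comparison; lra|].
split; [intros sigma Hsigma; apply half_circle_comparison; lra|].
split; [intros sigma Hsigma; apply half_circle_comparison; lra|].
exists (1 / 2); split; [lra|]; intros; apply comparison; lra.
Qed.
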